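(* Let $$H=48\,886\,437\,600=2^5\cdot 3^3\cdot 5^2\cdot 7^2\cdot 11\cdot 13\cdot 17\cdot 19,\qquad H'=64\,250\,746\,560=2^6\cdot 3^3\cdot 5\cdot 7\cdot 11\cdot 13\cdot 17\cdot 19\cdot 23.$$ Then $H<H'$ are consecutive highly composite numbers, with $$d(H)=3456,\qquad d(H')=3584,\qquad d(\gcd(H,H'))=1536,$$ so that $\dfrac{d(\gcd(H,H'))}{d(H)}=\dfrac49<\dfrac12$. Moreover this is the first such pair: for every pair $K<K'$ of consecutive highly composite numbers with $K<H$ one has $d(\gcd(K,K'))\ge\frac12 d(K)$.
   Context: $d(n)$ denotes the number of positive divisors of $n$. A positive integer $H$ is highly composite if $d(m)<d(H)$ for all integers $1\le m<H$. Two highly composite numbers $H<H'$ are consecutive if no highly composite number lies strictly between them. *)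

(* Defs.v *)
From mathcomp Require Import all_boot.

Set Implicit Arguments.
Unset Strict Implicit.
Unset Printing Implicit Defensive.

Definition num_divisors (n : nat) : nat := size (divisors n).

Definition highly_composite (n : nat) : Prop :=
  0 < n /\ forall m : nat, 1 <= m < n -> num_divisors m < num_divisors n.

Definition consecutive_hc (n n' : nat) : Prop :=
  [/\ highly_composite n, highly_composite n', n < n'
    & forall m : nat, n < m < n' -> ~ highly_composite m].

(* Main.v *)
(* A highly composite number has nonincreasing exponents along the primes, since
   exchanging two exponents in the wrong order would give a smaller number with
   as many divisors. As the product of the primes up to 31 exceeds H', the
   highly composite numbers up to H' are among the few thousand products of
   primes up to 29 with nonincreasing exponents. Each of these candidates is
   compared with an explicit list of 83 record holders: some record is at most
   the candidate and has at least as many divisors. Hence every highly composite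
   number up to H' is a record, and conversely, because below any m there is a
   highly composite number with at least as many divisors as m. The inequality
   on the greatest common divisors is then checked on neighbouring records. *)

Require Import Defs.
From Stdlib Require Import BinNat.
From Stdlib Require PeanoNat Pnat Nnat.
From mathcomp Require Import all_boot all_order all_algebra.

Set Implicit Arguments.
Unset Strict Implicit.
Unset Printing Implicit Defensive.

Import Order.TTheory GRing.Theory Num.Theory.
Local Open Scope nat_scope.

(** * Divisor counts from prime factorizations *)

(** [divisors] folds over the prime decomposition, and the step for a factor [p ^ e] multiplies the
    length of the list by [e + 1]. *)
Lemma num_divisorsE n :
  num_divisors n = \prod_(p <- primes n) (logn p n).+1.
Proof.
have size_add (f : nat * nat) s :
    size (PrimeDecompAux.add_divisors f s) = f.2.+1 * size s.
  case: f => p e /=; elim: e => [|e IHe] /=; first by rewrite mul1n.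
  by rewrite size_merge size_cat size_map IHe mulSn addnC.
rewrite -[RHS](big_map (fun p => (p, logn p n)) predT (fun f => f.2.+1)).
rewrite -prime_decompE /num_divisors /divisors.
elim: (prime_decomp n) => [|f r IHr]; first by rewrite big_nil.
by rewrite big_cons -IHr -size_add.
Qed.

Lemma num_divisorsM m n : 0 < m -> 0 < n -> coprime m n ->
  num_divisors (m * n) = num_divisors m * num_divisors n.
Proof.
move=> m0 n0 co; rewrite !num_divisorsE.
have perm_mn : perm_eq (primes (m * n)) (primes m ++ primes n).
  apply: uniq_perm; first exact: primes_uniq.
    by rewrite cat_uniq !primes_uniq -coprime_has_primes // co.
  by move=> p; rewrite mem_cat primesM.
rewrite (perm_big _ perm_mn) big_cat /= /muln.
congr (_ * _); apply: eq_big_seq => p; rewrite -logn_gt0 => lp;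
  rewrite lognM //; congr _.+1.
- suff -> : logn p n = 0 by rewrite addn0.
  apply: logn_coprime; apply: coprime_dvdl co.
  by move: lp; rewrite logn_gt0 mem_primes => /and3P[].
- suff -> : logn p m = 0 by [].
  apply: logn_coprime; rewrite coprime_sym in co; apply: coprime_dvdl co.
  by move: lp; rewrite logn_gt0 mem_primes => /and3P[].
Qed.

Lemma num_divisors_pfactor p e : prime p -> num_divisors (p ^ e) = e.+1.
Proof.
move=> p_pr; rewrite num_divisorsE; case: e => [|e].
  by rewrite expn0 big_nil.
by rewrite primesX // primes_prime // big_seq1 pfactorK.
Qed.

(** * Products of prime powers over a list of distinct primes *)

Section PrimePowerProduct.

Implicit Types (f g : nat -> nat) (ps : seq nat).

Lemma prod_pfactor_gt0 ps f : all prime ps -> 0 < \prod_(p <- ps) p ^ f p.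
Proof.
move=> /allP pr; rewrite big_seq; elim/big_ind: _ => // [m n m0 n0|p /pr p_pr].
  by rewrite muln_gt0 m0.
by rewrite expn_gt0 prime_gt0.
Qed.

Lemma coprime_prod_pfactor p e ps f : all prime (p :: ps) -> uniq (p :: ps) ->
  coprime (p ^ e) (\prod_(q <- ps) q ^ f q).
Proof.
move=> /= /andP[p_pr /allP pr] /andP[pNps _]; apply: coprimeXl.
rewrite big_seq; elim/big_ind: _ => [|m n pm pn|q qps].
- exact: coprimen1.
- by rewrite coprimeMr pm.
apply: coprimeXr; rewrite prime_coprime // dvdn_prime2 ?(pr _ qps) //.
by apply: contraNneq pNps => ->.
Qed.

Lemma logn_prod_pfactor ps f q : all prime ps -> uniq ps ->
  logn q (\prod_(p <- ps) p ^ f p) = if q \in ps then f q else 0.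
Proof.
elim: ps => [|p ps IHps] pr un; first by rewrite big_nil logn1.
have [/andP[p_pr prs] /andP[pNps uns]] := (pr, un).
rewrite big_cons lognM ?prod_pfactor_gt0 ?expn_gt0 ?prime_gt0 // IHps //.
rewrite lognX logn_prime // inE.
case: eqVneq => [->|_]; last by rewrite muln0.
by rewrite (negPf pNps) muln1 addn0.
Qed.

Lemma num_divisors_prod_pfactor ps f : all prime ps -> uniq ps ->
  num_divisors (\prod_(p <- ps) p ^ f p) = \prod_(p <- ps) (f p).+1.
Proof.
elim: ps => [|p ps IHps] pr un; first by rewrite !big_nil.
have [/andP[p_pr prs] /andP[pNps uns]] := (pr, un).
rewrite !big_cons num_divisorsM ?prod_pfactor_gt0 ?expn_gt0 ?prime_gt0 //.
  by rewrite num_divisors_pfactor // IHps.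
exact: coprime_prod_pfactor.
Qed.

Lemma gcdn_prod_pfactor ps f g : all prime ps -> uniq ps ->
  gcdn (\prod_(p <- ps) p ^ f p) (\prod_(p <- ps) p ^ g p) =
  \prod_(p <- ps) p ^ minn (f p) (g p).
Proof.
move=> pr un; apply: eqn_from_log; rewrite ?gcdn_gt0 ?prod_pfactor_gt0 // => q.
rewrite logn_gcd ?prod_pfactor_gt0 // !logn_prod_pfactor //.
by case: ifP.
Qed.

Lemma prod_pfactor_logn ps n : all prime ps -> uniq ps -> 0 < n ->
  {subset primes n <= ps} -> \prod_(p <- ps) p ^ logn p n = n.
Proof.
move=> pr un n0 sub; apply: eqn_from_log; rewrite ?prod_pfactor_gt0 // => q.
rewrite logn_prod_pfactor //; case: ifP => // /negbT qNps.
by apply/esym/eqP; rewrite eqn0Ngt logn_gt0 (contra (sub q)).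
Qed.

(** Serves to bound the part of [n] supported on [ps] before the prime factors of [n] are known to
    lie in [ps]. *)
Lemma prod_pfactor_dvdn ps n : all prime ps -> uniq ps ->
  \prod_(p <- ps) p ^ logn p n %| n.
Proof.
elim: ps => [|p ps IHps] pr un; first by rewrite big_nil dvd1n.
have [/andP[p_pr prs] /andP[pNps uns]] := (pr, un).
by rewrite big_cons Gauss_dvd ?pfactor_dvdnn ?IHps ?coprime_prod_pfactor.
Qed.

End PrimePowerProduct.

(** * Existence and exponents of highly composite numbers *)

(** Strong induction: if some smaller positive number has at least as many divisors as [m], descend
    to it; otherwise [m] itself is highly composite. *)
Lemma highly_composite_below m : 0 < m ->
  exists n, [/\ highly_composite n, n <= m & num_divisors m <= num_divisors n].
Proof.
elim/ltn_ind: m => m IHm m0.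
have [/existsP[k /andP[k0 dk]]|none] :=
  boolP [exists k : 'I_m, (0 < k) && (num_divisors m <= num_divisors k)].
  have [n [hn le_nk le_d]] := IHm k (ltn_ord k) k0.
  exists n; split=> //; first exact: leq_trans le_nk (ltnW (ltn_ord k)).
  exact: leq_trans dk le_d.
exists m; split=> //; split=> // k /andP[k0 km]; rewrite ltnNge.
apply: contra none => dk; apply/existsP; exists (Ordinal km).
by rewrite k0.
Qed.

(* Otherwise exchanging the exponents of p and q would give a smaller number
   with as many divisors. *)
Lemma highly_composite_logn n p q : highly_composite n ->
  prime p -> prime q -> p < q -> logn q n <= logn p n.
Proof.
move=> [n0 hn] p_pr q_pr pq; rewrite leqNgt; apply/negP => lt_log.
have coXY i j : coprime (p ^ i) (q ^ j).
  apply: coprimeXl; apply: coprimeXr.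
  by rewrite prime_coprime // dvdn_prime2 // neq_ltn pq.
have [m co_pm def_n] := pfactor_coprime p_pr n0.
have m0 : 0 < m by move: n0; rewrite def_n muln_gt0 => /andP[].
have [r co_qr def_m] := pfactor_coprime q_pr m0.
have r0 : 0 < r by move: m0; rewrite def_m muln_gt0 => /andP[].
have co_pr : coprime p r by move: co_pm; rewrite def_m coprimeMr => /andP[].
have log_q : logn q m = logn q n.
  by rewrite [in RHS]def_n mulnC logn_Gauss // coprimeXr // coprime_sym
    -[q]expn1 -[p]expn1 coXY.
move: def_n; rewrite {}def_m {}log_q.
set a := logn p n in lt_log *; set b := logn q n in lt_log *.
have dE i j : num_divisors (r * q ^ i * p ^ j) = num_divisors r * i.+1 * j.+1.
  have q0 : 0 < q ^ i by rewrite expn_gt0 prime_gt0.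
  have p0 : 0 < p ^ j by rewrite expn_gt0 prime_gt0.
  rewrite num_divisorsM ?muln_gt0 ?r0 //; last first.
    by rewrite coprimeMl coprime_sym coprimeXl //= coprime_sym.
  by rewrite num_divisorsM ?num_divisors_pfactor // coprime_sym coprimeXl.
move=> def_n; suff lt_mn : 0 < r * q ^ a * p ^ b < n.
  by have := hn _ lt_mn; rewrite def_n !dE mulnAC ltnn.
(* Once [r] and the common factor [q ^ a * p ^ a] are cancelled, what remains is
   [p ^ (b - a) < q ^ (b - a)]. *)
rewrite !muln_gt0 r0 !expn_gt0 !prime_gt0 //= def_n -!mulnA ltn_pmul2l //.
rewrite -(subnK (ltnW lt_log)) !expnD !mulnA.
have -> : q ^ a * p ^ (b - a) * p ^ a = p ^ (b - a) * (q ^ a * p ^ a).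
  by rewrite -!mulnA mulnCA.
have -> : q ^ (b - a) * q ^ a * p ^ a = q ^ (b - a) * (q ^ a * p ^ a).
  by rewrite mulnA.
by rewrite ltn_pmul2r ?muln_gt0 ?expn_gt0 ?prime_gt0 // ltn_exp2r // subn_gt0.
Qed.

(** * Transfer to binary arithmetic, for evaluation by [vm_compute] *)

Lemma nat_of_binE x : nat_of_bin x = N.to_nat x.
Proof.
case: x => // p; rewrite [RHS]/= [LHS]/=.
elim: p => [p IHp|p IHp|] //=; rewrite NatTrec.doubleE IHp -mul2n.
- by rewrite Pnat.Pos2Nat.inj_xI.
- by rewrite Pnat.Pos2Nat.inj_xO.
Qed.

Lemma nat_of_binM x y : (x * y)%num = x * y :> nat.
Proof. by rewrite !nat_of_binE Nnat.N2Nat.inj_mul. Qed.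

Lemma nat_of_binX x y : (x ^ y)%num = x ^ y :> nat.
Proof.
rewrite !nat_of_binE Nnat.N2Nat.inj_pow.
by elim: (N.to_nat y) => // n /= ->; rewrite expnS.
Qed.

Lemma bin_of_natM m n : bin_of_nat (m * n) = (bin_of_nat m * bin_of_nat n)%num.
Proof. by rewrite -[RHS]nat_of_binK nat_of_binM !bin_of_natK. Qed.

Lemma bin_of_natX m n : bin_of_nat (m ^ n) = (bin_of_nat m ^ bin_of_nat n)%num.
Proof. by rewrite -[RHS]nat_of_binK nat_of_binX !bin_of_natK. Qed.

Lemma leq_bin (x y : N) : (x <= y) = (x <=? y)%num.
Proof.
have le_iff : (x <= y)%num <-> (N.to_nat x <= N.to_nat y)%coq_nat.
  by rewrite /N.le Nnat.N2Nat.inj_compare PeanoNat.Nat.compare_le_iff.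
rewrite !nat_of_binE.
by apply/ssrnat.leP/idP => [/le_iff/N.leb_le|/N.leb_le/le_iff].
Qed.

Lemma eqb_bin (x y : N) : (x =? y)%num -> x = y :> nat.
Proof. by move/N.eqb_eq->. Qed.

Lemma ltn_bin (x y : N) : (x < y) = (x <? y)%num.
Proof. by rewrite ltnNge leq_bin N.ltb_antisym. Qed.

(** * Enumeration of nonincreasing exponent sequences *)

(* A state (v, d, a) stands for a number v with d divisors in which the last
   prime treated has exponent a. *)
Definition extend_state (X : N) (p : nat) (s : N * N * nat) :=
  let: (v, d, a) := s in
  [seq t <- [seq ((v * bin_of_nat p ^ bin_of_nat b)%num,
                  (d * bin_of_nat b.+1)%num, b) | b <- iota 0 a.+1]
   | (t.1.1 <=? X)%num].

Definition extend_states X S p := flatten (map (extend_state X p) S).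

(** The [a] of the initial state is a ceiling for the exponent of the first prime. *)
Definition candidates X a ps :=
  foldl (extend_states X) [:: (1%num, 1%num, a)] ps.

(** Partial products only grow along [ps], so discarding those above [X] loses no product that ends
    up at most [X]. The arbitrary initial state lets the induction on [ps] go through. *)
Lemma extend_states_complete (X : N) S (f : nat -> nat) v d a ps :
  all prime ps -> path geq a (map f ps) ->
  v * \prod_(p <- ps) p ^ f p <= X -> (bin_of_nat v, bin_of_nat d, a) \in S ->
  (bin_of_nat (v * \prod_(p <- ps) p ^ f p),
   bin_of_nat (d * \prod_(p <- ps) (f p).+1), last a (map f ps))
    \in foldl (extend_states X) S ps.
Proof.
elim: ps S v d a => [|p ps IHps] S v d a; first by rewrite !big_nil !muln1.
rewrite !big_cons !mulnA => pr noninc le_X S_a.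
have [/= p_pr prs] := andP pr; have [/= le_a noninc'] := andP noninc.
apply: IHps => //; apply/flattenP.
exists (extend_state X p (bin_of_nat v, bin_of_nat d, a)).
  exact: map_f.
rewrite mem_filter; apply/andP; split.
  rewrite /= -leq_bin bin_of_natK.
  by rewrite (leq_trans _ le_X) // leq_pmulr // prod_pfactor_gt0.
apply/mapP; exists (f p); first by rewrite mem_iota.
by rewrite !bin_of_natM bin_of_natX.
Qed.

Lemma candidates_complete (X : N) (f : nat -> nat) a ps :
  all prime ps -> path geq a (map f ps) -> \prod_(p <- ps) p ^ f p <= X ->
  (bin_of_nat (\prod_(p <- ps) p ^ f p),
   bin_of_nat (\prod_(p <- ps) (f p).+1), last a (map f ps))
    \in candidates X a ps.
Proof.
move=> pr noninc le_X.
have := @extend_states_complete X [:: (1%num, 1%num, a)] f 1 1 a ps.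
by rewrite !mul1n; apply=> //; exact: mem_head.
Qed.

(** * Exponent vectors and the table of records *)

(** The prime 31 is included so that the enumeration itself shows its exponent to be 0. *)
Definition basis := [:: 2; 3; 5; 7; 11; 13; 17; 19; 23; 29; 31].

Lemma prime_leq31 p : prime p -> p <= 31 -> p \in basis.
Proof. by do 32?[case: p => [|p] //]. Qed.

(** The default 0 of [nth] restores the trailing zeros that the vectors omit. *)
Definition exponent (es : seq nat) p := nth 0 es (index p basis).

Definition number es := \prod_(p <- basis) p ^ exponent es p.

(** A plain [foldr] in [N], so that the product can be evaluated. *)
Definition prodN (F : nat -> N) := foldr (fun p => N.mul (F p)) 1%num basis.

Definition numberN es :=
  prodN (fun p => bin_of_nat p ^ bin_of_nat (exponent es p))%num.

Definition divisorsN es := prodN (fun p => bin_of_nat (exponent es p).+1).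

Definition gcd_divisorsN es fs :=
  prodN (fun p => bin_of_nat (minn (exponent es p) (exponent fs p)).+1).

Lemma prodNE F : prodN F = \prod_(p <- basis) F p :> nat.
Proof.
rewrite /prodN; elim: basis => [|p ps IHps]; first by rewrite big_nil.
by rewrite big_cons -IHps -nat_of_binM.
Qed.

Lemma numberE es : number es = numberN es.
Proof.
by rewrite prodNE; apply: eq_bigr => p _; rewrite nat_of_binX !bin_of_natK.
Qed.

Lemma num_divisors_number es : num_divisors (number es) = divisorsN es.
Proof.
rewrite num_divisors_prod_pfactor // prodNE.
by apply: eq_bigr => p _; rewrite bin_of_natK.
Qed.

Lemma num_divisors_gcdn_number es fs :
  num_divisors (gcdn (number es) (number fs)) = gcd_divisorsN es fs.
Proof.
rewrite gcdn_prod_pfactor // num_divisors_prod_pfactor // prodNE.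
by apply: eq_bigr => p _; rewrite bin_of_natK.
Qed.

(* Exponent vectors, without trailing zeros, of the highly composite numbers up
   to H' = 64250746560. *)
Definition records : seq (seq nat) :=
  [:: [::]; [:: 1]; [:: 2]; [:: 1; 1]; [:: 2; 1]; [:: 3; 1]; [:: 2; 2];
      [:: 4; 1]; [:: 2; 1; 1]; [:: 3; 1; 1]; [:: 2; 2; 1]; [:: 4; 1; 1];
      [:: 3; 2; 1]; [:: 4; 2; 1]; [:: 3; 1; 1; 1]; [:: 2; 2; 1; 1];
      [:: 4; 1; 1; 1]; [:: 3; 2; 1; 1]; [:: 4; 2; 1; 1]; [:: 3; 3; 1; 1];
      [:: 5; 2; 1; 1]; [:: 4; 3; 1; 1]; [:: 6; 2; 1; 1]; [:: 4; 2; 2; 1];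
      [:: 3; 2; 1; 1; 1]; [:: 4; 4; 1; 1]; [:: 5; 2; 2; 1]; [:: 4; 2; 1; 1; 1];
      [:: 3; 3; 1; 1; 1]; [:: 5; 2; 1; 1; 1]; [:: 4; 3; 1; 1; 1];
      [:: 6; 2; 1; 1; 1]; [:: 4; 2; 2; 1; 1]; [:: 5; 3; 1; 1; 1];
      [:: 4; 4; 1; 1; 1]; [:: 5; 2; 2; 1; 1]; [:: 6; 3; 1; 1; 1];
      [:: 4; 2; 1; 1; 1; 1]; [:: 3; 3; 1; 1; 1; 1]; [:: 5; 2; 1; 1; 1; 1];
      [:: 4; 3; 1; 1; 1; 1]; [:: 6; 2; 1; 1; 1; 1]; [:: 4; 2; 2; 1; 1; 1];
      [:: 5; 3; 1; 1; 1; 1]; [:: 4; 4; 1; 1; 1; 1]; [:: 5; 2; 2; 1; 1; 1];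
      [:: 6; 3; 1; 1; 1; 1]; [:: 4; 3; 2; 1; 1; 1]; [:: 6; 2; 2; 1; 1; 1];
      [:: 7; 3; 1; 1; 1; 1]; [:: 5; 3; 2; 1; 1; 1]; [:: 4; 4; 2; 1; 1; 1];
      [:: 4; 3; 1; 1; 1; 1; 1]; [:: 6; 3; 2; 1; 1; 1];
      [:: 4; 2; 2; 1; 1; 1; 1]; [:: 5; 3; 1; 1; 1; 1; 1];
      [:: 4; 4; 1; 1; 1; 1; 1]; [:: 5; 2; 2; 1; 1; 1; 1];
      [:: 6; 3; 1; 1; 1; 1; 1]; [:: 4; 3; 2; 1; 1; 1; 1];
      [:: 6; 2; 2; 1; 1; 1; 1]; [:: 7; 3; 1; 1; 1; 1; 1];
      [:: 5; 3; 2; 1; 1; 1; 1]; [:: 4; 4; 2; 1; 1; 1; 1];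
      [:: 4; 3; 1; 1; 1; 1; 1; 1]; [:: 6; 3; 2; 1; 1; 1; 1];
      [:: 5; 4; 2; 1; 1; 1; 1]; [:: 5; 3; 1; 1; 1; 1; 1; 1];
      [:: 4; 4; 1; 1; 1; 1; 1; 1]; [:: 6; 4; 2; 1; 1; 1; 1];
      [:: 5; 2; 2; 1; 1; 1; 1; 1]; [:: 6; 3; 1; 1; 1; 1; 1; 1];
      [:: 4; 3; 2; 1; 1; 1; 1; 1]; [:: 6; 2; 2; 1; 1; 1; 1; 1];
      [:: 7; 3; 1; 1; 1; 1; 1; 1]; [:: 5; 3; 2; 1; 1; 1; 1; 1];
      [:: 4; 4; 2; 1; 1; 1; 1; 1]; [:: 6; 3; 2; 1; 1; 1; 1; 1];
      [:: 5; 4; 2; 1; 1; 1; 1; 1]; [:: 7; 3; 2; 1; 1; 1; 1; 1];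
      [:: 6; 4; 2; 1; 1; 1; 1; 1]; [:: 5; 3; 2; 2; 1; 1; 1; 1];
      [:: 6; 3; 1; 1; 1; 1; 1; 1; 1]].

Definition record_values := [seq (numberN es, divisorsN es) | es <- records].

(** The test [s.2 == 0] asks that the last prime treated, which is 31 for [basis], has exponent 0 in
    every candidate. *)
Definition dominated (rs : seq (N * N)) (S : seq (N * N * nat)) :=
  all (fun s => (s.2 == 0) &&
         has (fun r => (r.1 <=? s.1.1) && (s.1.2 <=? r.2))%num rs) S.

Lemma dominatedP rs S v d a : dominated rs S -> (v, d, a) \in S ->
  a = 0 /\ exists2 r, r \in rs & (r.1 <= v) && (d <= r.2).
Proof.
move=> /allP dom /dom/andP[/eqP a0 /hasP[r r_rs le_r]].
by split=> //; exists r; rewrite ?leq_bin.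
Qed.

(* The bound 2 ^ 37 justifies starting the enumeration with exponent 36. *)
Definition records_complete X :=
  [&& (X <? 2 ^ 37)%num, dominated record_values (candidates X 36 basis)
    & all (fun es => numberN es <=? X)%num records].

Lemma records_complete_to_H' : records_complete 64250746560%num.
Proof. by vm_compute. Qed.

(** The literal is H. The gcd clause is the claimed bound cleared of its denominator; it is confined
    to numbers below H because it fails at H, where 3456 exceeds 2 * 1536. *)
Definition record_step es fs :=
  [&& (numberN es <? numberN fs)%num, (divisorsN es <? divisorsN fs)%num &
      (numberN es <? 48886437600)%num ==>
      (divisorsN es <=? 2 * gcd_divisorsN es fs)%num].

Lemma sorted_records : sorted record_step records.
Proof. by vm_compute. Qed.

(** * Records as the highly composite numbers up to the bound *)

(** The exponents of [n] give a candidate, so some record is at most [n] with at least as many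
    divisors; as [n] is highly composite, that record cannot be smaller than [n]. *)
Lemma highly_composite_record (X : N) n : records_complete X ->
  highly_composite n -> n <= X -> exists2 es, es \in records & n = number es.
Proof.
case/and3P=> lt_X dom _ hc_n le_n; have [n0 hn] := hc_n.
have noninc : path geq 36 [seq logn p n | p <- basis].
  rewrite /= !highly_composite_logn // !andbT.
  (* Only the ceiling 36 on the exponent of 2 is left to prove. *)
  have le_exp : 2 ^ logn 2 n <= n by rewrite dvdn_leq ?pfactor_dvdnn.
  rewrite -ltnS -(ltn_exp2l _ _ (isT : 1 < 2)).
  move: lt_X; rewrite -ltn_bin nat_of_binX.
  by apply/leq_ltn_trans/leq_trans/le_n.
have le_prod : \prod_(p <- basis) p ^ logn p n <= X.
  by rewrite (leq_trans _ le_n) // dvdn_leq ?prod_pfactor_dvdn.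
have [] :=
  dominatedP dom (candidates_complete (isT : all prime basis) noninc le_prod).
rewrite [last _ _]/= => log31.
(* Exponents do not increase along the primes, so exponent 0 at 31 excludes every larger prime. *)
have sub_n : {subset primes n <= basis}.
  move=> q; rewrite -logn_gt0 => log_q.
  have q_pr : prime q by move: log_q; rewrite logn_gt0 mem_primes => /and3P[].
  have [le_q|lt_q] := leqP q 31; first exact: prime_leq31.
  have := highly_composite_logn hc_n (isT : prime 31) q_pr lt_q.
  by rewrite leqNgt log31 log_q.
have dE := num_divisors_prod_pfactor (logn^~ n) (isT : all prime basis) isT.
rewrite -dE prod_pfactor_logn // !bin_of_natK => -[_ /mapP[es es_rec ->]].
rewrite -numberE -num_divisors_number => /andP[le_es].
move=> le_d; exists es => //; apply/eqP.
rewrite eqn_leq le_es andbT leqNgt; apply: contraL le_d => lt_es.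
rewrite -ltnNge; apply: hn; rewrite lt_es andbT.
exact: prod_pfactor_gt0.
Qed.

Lemma record_stepP es fs : record_step es fs ->
  [/\ number es < number fs,
      num_divisors (number es) < num_divisors (number fs)
    & (numberN es <? 48886437600)%num -> num_divisors (number es) <=
      2 * num_divisors (gcdn (number es) (number fs))].
Proof.
case/and3P; rewrite -!ltn_bin -leq_bin nat_of_binM -!numberE.
rewrite -num_divisors_gcdn_number -!num_divisors_number => lt_n lt_d.
by move/implyP.
Qed.

Lemma records_lt l1 es l2 fs : records = l1 ++ es :: l2 -> fs \in l2 ->
  number es < number fs /\ num_divisors (number es) < num_divisors (number fs).
Proof.
move=> def_r fs_l2.
(* The gcd clause of [record_step] does not compose; the two strict inequalities do, and so pass
   from neighbours to all pairs. *)
pose r gs hs := (number gs < number hs) &&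
  (num_divisors (number gs) < num_divisors (number hs)).
have r_trans : transitive r.
  move=> y x z /andP[xy xy'] /andP[yz yz'].
  by rewrite /r (ltn_trans xy yz) (ltn_trans xy' yz').
have : sorted r records.
  apply: sub_sorted sorted_records => gs hs /record_stepP[lt_n lt_d _].
  exact/andP.
rewrite sorted_pairwise // def_r pairwise_cat pairwise_cons.
by case/and4P=> _ _ /allP/(_ _ fs_l2)/andP.
Qed.

(** If [es] came after [fs] in the list, it would have strictly more divisors. *)
Lemma records_mono es fs : es \in records -> fs \in records ->
  num_divisors (number es) <= num_divisors (number fs) ->
  number es <= number fs.
Proof.
move=> es_r fs_r le_d; case/splitPr def_r: {1}records / fs_r => [l1 l2].
move: es_r; rewrite def_r mem_cat inE => /or3P[es_l1|/eqP->//|es_l2].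
  case/splitPr def_l1: {1}l1 / es_l1 => [l3 l4].
  have [||/ltnW//] := @records_lt l3 es (l4 ++ fs :: l2) fs.
  - by rewrite def_r def_l1 -catA.
  - by rewrite mem_cat mem_head orbT.
by have [_] := records_lt def_r es_l2; rewrite ltnNge le_d.
Qed.

(** A highly composite number below the record with at least as many divisors is itself a record,
    and monotonicity along the list makes the two equal. *)
Lemma record_highly_composite X es : records_complete X ->
  es \in records -> highly_composite (number es).
Proof.
move=> complete es_r; have es0 : 0 < number es by exact: prod_pfactor_gt0.
have [n [hc_n le_n le_d]] := highly_composite_below es0.
have le_X : number es <= X.
  by case/and3P: complete => _ _ /allP/(_ _ es_r); rewrite -leq_bin -numberE.
have [fs fs_r def_n] :=
  highly_composite_record complete hc_n (leq_trans le_n le_X).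
suff -> : number es = n by [].
by apply/eqP; rewrite eqn_leq le_n andbT def_n records_mono // -def_n.
Qed.

(** * Consecutive highly composite numbers as neighbouring records *)

(** Both numbers are records. If [K'] were not the record right after [K], that record would be a
    highly composite number strictly between them. *)
Lemma consecutive_hc_record X K K' : records_complete X ->
  consecutive_hc K K' -> K' <= X -> exists es fs,
  [/\ record_step es fs, K = number es & K' = number fs].
Proof.
move=> complete [hc_K hc_K' lt_K none] le_K'.
have [es es_r def_K] :=
  highly_composite_record complete hc_K (leq_trans (ltnW lt_K) le_K').
have [fs fs_r def_K'] := highly_composite_record complete hc_K' le_K'.
case/splitPr def_r: {1}records / es_r => [l1 l2].
have {}fs_r : fs \in l2.
  move: fs_r; rewrite def_r mem_cat inE => /or3P[fs_l1|/eqP def_fs|//].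
    case/splitPr def_l1: {1}l1 / fs_l1 => [l3 l4].
    have [] := @records_lt l3 fs (l4 ++ es :: l2) es.
    - by rewrite def_r def_l1 -catA.
    - by rewrite mem_cat mem_head orbT.
    by rewrite -def_K -def_K' ltnNge (ltnW lt_K).
  by move: lt_K; rewrite def_K def_K' def_fs ltnn.
case: l2 => // gs l2 in def_r fs_r *.
have step : record_step es gs.
  have := sorted_records; rewrite def_r => /cat_sorted2[_].
  by rewrite /= => /andP[].
exists es, gs; split=> //; rewrite def_K'.
move: fs_r; rewrite inE => /predU1P[->//|fs_l2].
have lt_gs : number gs < number fs.
  by have [] := @records_lt (rcons l1 es) gs l2 fs _ fs_l2; rewrite ?cat_rcons.
have [lt_es _ _] := record_stepP step.
case: (none (number gs)); first by rewrite def_K lt_es def_K'.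
apply: record_highly_composite complete _.
by rewrite def_r mem_cat !inE eqxx !orbT.
Qed.

(** A highly composite number strictly between would be a record, but the strictly increasing list
    has no place for it. *)
Lemma consecutive_records X l1 es fs l2 : records_complete X ->
  records = l1 ++ [:: es, fs & l2] -> consecutive_hc (number es) (number fs).
Proof.
move=> complete def_r.
have es_r : es \in records by rewrite def_r mem_cat mem_head orbT.
have fs_r : fs \in records by rewrite def_r mem_cat !inE eqxx !orbT.
have hc_fs := record_highly_composite complete fs_r.
have [lt_fs _] := records_lt def_r (mem_head _ _).
split=> // [|m /andP[lt_m gt_m] hc_m].
  exact: record_highly_composite complete es_r.
have le_X : number fs <= X.
  by case/and3P: complete => _ _ /allP/(_ _ fs_r); rewrite -leq_bin -numberE.
have [gs gs_r def_m] :=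
  highly_composite_record complete hc_m (leq_trans (ltnW gt_m) le_X).
move: gs_r; rewrite def_r mem_cat !inE => /or4P[gs_l1|/eqP def|/eqP def|gs_l2].
- case/splitPr def_l1: {1}l1 / gs_l1 => [l3 l4].
  have [] := @records_lt l3 gs (l4 ++ [:: es, fs & l2]) es.
  - by rewrite def_r def_l1 -catA.
  - by rewrite mem_cat mem_head orbT.
  by rewrite -def_m ltnNge (ltnW lt_m).
- by move: lt_m; rewrite def_m def ltnn.
- by move: gt_m; rewrite def_m def ltnn.
have [] := @records_lt (rcons l1 es) fs l2 gs _ gs_l2; rewrite ?cat_rcons //.
by move: gt_m; rewrite def_m ltnNge => /negP gt_m /ltnW/gt_m.
Qed.

(** * The ratio of divisor counts and the final assembly *)

Local Open Scope ring_scope.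

Lemma ratio_four_ninths (F : numFieldType) (a b : nat) :
  (0 < b)%N -> (a * 9)%N = (4 * b)%N -> a%:R / b%:R = 4 / 9 :> F.
Proof.
move=> b0 eq_ab; apply/eqP.
by rewrite eqr_div ?pnatr_eq0 -?lt0n // -!natrM eq_ab.
Qed.

Lemma four_ninths_lt_half (F : numFieldType) : 4 / 9 < 1 / 2 :> F.
Proof.
rewrite ltr_pdivrMr ?ltr0n // mulrAC ltr_pdivlMr ?ltr0n //.
by rewrite mul1r -natrM ltr_nat.
Qed.

Theorem proposition3p1 (H H' : nat)
    (H_def : H = 48886437600%num)
    (H'_def : H' = 64250746560%num) :
  [/\ H = (2 ^ 5 * 3 ^ 3 * 5 ^ 2 * 7 ^ 2 * 11 * 13 * 17 * 19)%N,
      H' = (2 ^ 6 * 3 ^ 3 * 5 * 7 * 11 * 13 * 17 * 19 * 23)%N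
    & consecutive_hc H H'] /\
  [/\ num_divisors H = 3456%N,
      num_divisors H' = 3584%N
    & num_divisors (gcdn H H') = 1536%N] /\
  ((num_divisors (gcdn H H'))%:R / (num_divisors H)%:R = 4 / 9 :> rat /\
   4 / 9 < 1 / 2 :> rat) /\
  (forall K K' : nat, consecutive_hc K K' -> (K < H)%N ->
     1 / 2 * (num_divisors K)%:R <= (num_divisors (gcdn K K'))%:R :> rat).
Proof.
pose es := [:: 5; 3; 2; 2; 1; 1; 1; 1]%N.
pose es' := [:: 6; 3; 1; 1; 1; 1; 1; 1; 1]%N.
have complete := records_complete_to_H'.
(* With the literals generalized, conversion cannot expand them in unary. *)
move: H_def H'_def complete.
have [hN def_hN] : exists hN, hN = 48886437600%num by eexists.
have [hN' def_hN'] : exists hN', hN' = 64250746560%num by eexists.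
rewrite -def_hN -def_hN' => H_def H'_def complete.
have Hes : H = number es.
  by rewrite H_def numberE; apply: eqb_bin; rewrite def_hN; vm_compute.
have Hes' : H' = number es'.
  by rewrite H'_def numberE; apply: eqb_bin; rewrite def_hN'; vm_compute.
have dH : num_divisors H = 3456%N.
  rewrite Hes num_divisors_number -[RHS]bin_of_natK.
  by apply: eqb_bin; vm_compute.
have dH' : num_divisors H' = 3584%N.
  rewrite Hes' num_divisors_number -[RHS]bin_of_natK.
  by apply: eqb_bin; vm_compute.
have dG : num_divisors (gcdn H H') = 1536%N.
  rewrite Hes Hes' num_divisors_gcdn_number -[RHS]bin_of_natK.
  by apply: eqb_bin; vm_compute.
have hcHH' : consecutive_hc H H'.
  rewrite Hes Hes'.
  (* The vectors of [H] and [H'] are the last two of the 83 records. *)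
  apply: (consecutive_records (l1 := take 81 records) (l2 := [::]) complete).
  by vm_compute.
split; [split=> // | split; [by [] | split; [split|]]].
(* Stated for variables, so that no power is evaluated in unary. *)
- have assoc (a b c d e f g h i j k : nat) :
      (a ^ 5 * (b ^ 3 * (c ^ 2 * (d ^ 2 * (e ^ 1 * (f ^ 1 * (g ^ 1 * (h ^ 1 *
        (i ^ 0 * (j ^ 0 * (k ^ 0 * 1)))))))))) =
       a ^ 5 * b ^ 3 * c ^ 2 * d ^ 2 * e * f * g * h)%N.
    by rewrite !expn0 !expn1 !muln1 !mulnA.
  by rewrite Hes /number /basis !big_cons big_nil /exponent assoc.
- have assoc (a b c d e f g h i j k : nat) :
      (a ^ 6 * (b ^ 3 * (c ^ 1 * (d ^ 1 * (e ^ 1 * (f ^ 1 * (g ^ 1 * (h ^ 1 *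
        (i ^ 1 * (j ^ 0 * (k ^ 0 * 1)))))))))) =
       a ^ 6 * b ^ 3 * c * d * e * f * g * h * i)%N.
    by rewrite !expn0 !expn1 !muln1 !mulnA.
  by rewrite Hes' /number /basis !big_cons big_nil /exponent assoc.
- by rewrite dG dH; apply: ratio_four_ninths; vm_compute.
- exact: four_ninths_lt_half.
move=> K K' hcKK' lt_KH; have [hc_K hc_K' lt_KK' none] := hcKK'.
(* Otherwise the highly composite number [H] would lie strictly between [K] and [K']. *)
have le_K'H : (K' <= H)%N.
  rewrite leqNgt; apply/negP => lt_HK'; apply: (none H); first by rewrite lt_KH.
  by case: hcHH'.
have le_K' : (K' <= hN')%N.
  by rewrite -H'_def (leq_trans le_K'H) //; case: hcHH' => _ _ /ltnW.
have [fs [gs [/record_stepP[_ _ step] def_K def_K']]] :=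
  consecutive_hc_record complete hcKK' le_K'.
rewrite mul1r mulrC ler_pdivrMr ?ltr0n // -natrM ler_nat mulnC def_K def_K'.
by apply: step; rewrite -def_hN -ltn_bin -numberE -def_K -H_def.
Qed.
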